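(* Let $p$ be a prime and let $(\mathcal{A}_p,f)$ be a connected affine quandle of order $p$, where $f(x)=tx$ on $\mathbb{Z}_p$ and $n$ is the order of $f$. Let $V_{triv}$ be the span of $v_{triv}=\sum_{i=0}^{p-1}v_i$ in $\mathbb{C}[\mathcal{A}_p]$, and let $\psi_1,\dots,\psi_{(p-1)/n}$ be a complete list of pairwise inequivalent complex irreducible representations of degree $n$ of $Inn(\mathcal{A}_p)$. Then the quandle ring decomposes as a direct sum of simple right ideals $$\mathbb{C}[\mathcal{A}_p]=V_{triv}\oplus\bigoplus_{j=1}^{(p-1)/n}V_j,$$ where $V_j$ is a simple module affording $\psi_j$ (that is, the restriction of the representation $\phi_{\mathcal{A}_p}$ of $Inn(\mathcal{A}_p)$ to $V_j$ is equivalent to $\psi_j$) for each $1\le j\le (p-1)/n$.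
   Context: A quandle is a set $X$ with a binary operation $\triangleright$ such that $x\triangleright x=x$; for all $x,y$ there is a unique $z$ with $x=z\triangleright y$; and $(x\triangleright y)\triangleright z=(x\triangleright z)\triangleright(y\triangleright z)$. For $y\in X$ let $R_y(x)=x\triangleright y$; $Inn(X)$ is the group of permutations of $X$ generated by all $R_y$. $X$ is connected if $Inn(X)$ acts transitively on $X$. For $t\in\mathbb{Z}_p^{\ast}$ and $f(x)=tx$, $(\mathcal{A}_p,f)$ denotes the affine quandle on $\mathbb{Z}_p$ with $x\triangleright y=tx+(1-t)y$. The order $n$ of $f$ is the least $n\in\mathbb{N}$ with $t^n\equiv 1\pmod p$. (Every connected quandle of prime order $p$ is isomorphic to such a quandle.) The group $Inn(\mathcal{A}_p)$ has, up to equivalence, exactly $(p-1)/n$ complex irreducible representations of degree $n$. The quandle ring $\mathbb{C}[X]$ is the complex vector space with basis $X$, with the bilinear (generally non-associative) multiplication extending $\triangleright$. For $X=\mathcal{A}_p$ the basis elements are written $v_0,\dots,v_{p-1}$, with $v_i\cdot v_j=v_{i\triangleright j}$. The representation $\phi_{\mathcal{A}_p}:Inn(\mathcal{A}_p)\to GL(\mathbb{C}[\mathcal{A}_p])$ is the permutation representation $\phi_{\mathcal{A}_p}(g)(v_i)=v_{g(i)}$. A right ideal is a subspace closed under right multiplication by $\mathbb{C}[\mathcal{A}_p]$, equivalently a $\phi_{\mathcal{A}_p}$-invariant subspace; it is simple if it is nonzero and contains no nonzero proper right ideal. *)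

(* Defs.v *)
From mathcomp Require Import all_boot all_order all_algebra all_fingroup.
From mathcomp Require Import mxrepresentation ring.
From mathcomp Require Export reals complex.

Set Implicit Arguments.
Unset Strict Implicit.
Unset Printing Implicit Defensive.

Import GroupScope GRing.Theory.
Local Open Scope ring_scope.

Record quandle (X : Type) := Quandle {
  qop :> X -> X -> X;
  qop_idem : forall x, qop x x = x;
  qop_div : forall x y, exists! z, x = qop z y;
  qop_dist : forall x y z, qop (qop x y) z = qop (qop x z) (qop y z) }.

Lemma rtrans_inj (X : Type) (Q : quandle X) (y : X) : injective (fun x => Q x y).
Proof.
move=> x1 x2 /= e; have [z [_ uz]] := qop_div Q (Q x1 y) y.
by rewrite -(uz x1 erefl) -(uz x2 e).
Qed.

Definition rtrans (X : finType) (Q : quandle X) (y : X) : {perm X} :=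
  perm (@rtrans_inj X Q y).

Definition Inn (X : finType) (Q : quandle X) : {group {perm X}} :=
  <<[set rtrans Q y | y in X]>>%G.

Definition qconnected (X : finType) (Q : quandle X) : bool :=
  [transitive Inn Q, on [set: X] | 'P].

Section AffineQuandle.

Variables (p : nat) (t : 'F_p).
Hypothesis t_neq0 : t != 0.

Let op (x y : 'F_p) : 'F_p := t * x + (1 - t) * y.

Fact affine_idem x : op x x = x.
Proof. by rewrite /op; ring. Qed.

Fact affine_div x y : exists! z, x = op z y.
Proof.
exists (t^-1 * (x - (1 - t) * y)); split=> [|z ->]; rewrite /op.
  by rewrite mulVKf // subrK.
by rewrite addrK mulKf.
Qed.

Fact affine_dist x y z : op (op x y) z = op (op x z) (op y z).
Proof. by rewrite /op; ring. Qed.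

Definition affine_quandle : quandle 'F_p :=
  Quandle affine_idem affine_div affine_dist.

End AffineQuandle.

(* A finite quandle is carried here by an ordinal type 'I_m; 'F_p is one, with
   m = (Zp_trunc (pdiv p)).+2, which equals p for p prime. The vector
   \sum_i a_i v_i of F[X] is the row vector of its coordinates a_i. A subspace
   of F[X] is given, as usual in mxalgebra, as the row space of a matrix. *)

Section QuandleRing.

Variables (F : fieldType) (m : nat) (Q : quandle 'I_m).

Definition qbasis (i : 'I_m) : 'rV[F]_m := delta_mx 0 i.

Definition qmul (u w : 'rV[F]_m) : 'rV[F]_m :=
  \sum_i \sum_j (u 0 i * w 0 j) *: qbasis (Q i j).

Definition right_ideal (V : 'M[F]_m) : Prop :=
  forall u w : 'rV[F]_m, (u <= V)%MS -> (qmul u w <= V)%MS.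

Definition simple_right_ideal (V : 'M[F]_m) : Prop :=
  [/\ right_ideal V, V != 0 &
      forall W : 'M[F]_m,
        right_ideal W -> (W <= V)%MS -> W != 0 -> (V <= W)%MS].

Definition v_triv : 'rV[F]_m := \sum_i qbasis i.

Definition V_triv : 'M[F]_m := <<v_triv>>%MS.

(* Matrices act on row vectors from the right and permutations are composed
   from left to right, so g |-> perm_mx g is multiplicative; it is the
   permutation representation by qrepr_basis below. *)
Fact qrepr_subproof : mx_repr (Inn Q) (fun g : 'S_m => perm_mx g : 'M[F]_m).
Proof. by split=> [|g h _ _]; rewrite ?perm_mx1 ?perm_mxM. Qed.

Definition qrepr : mx_representation F (Inn Q) m :=
  MxRepresentation qrepr_subproof.

Lemma qmul_basis i j : qmul (qbasis i) (qbasis j) = qbasis (Q i j).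
Proof.
rewrite /qmul (bigD1 i) //= [X in _ + X]big1 ?addr0 => [|k nki]; last first.
  by apply: big1 => l _; rewrite !mxE (negPf nki) andbF mul0r scale0r.
rewrite (bigD1 j) //= big1 ?addr0 => [|k nkj].
  by rewrite !mxE !eqxx mul1r scale1r.
by rewrite !mxE (negPf nkj) andbF mulr0 scale0r.
Qed.

Lemma qrepr_basis (g : 'S_m) i : qbasis i *m qrepr g = qbasis (g i).
Proof.
apply/rowP=> j; rewrite -rowE !mxE eqxx /= eq_sym.
by congr (_%:R); rewrite eq_sym.
Qed.

End QuandleRing.

Definition affords (F : fieldType) (gT : finGroupType) (G : {group gT})
    (m : nat) (rG : mx_representation F G m) (V : 'M[F]_m)
    (n : nat) (rho : mx_representation F G n) : Prop :=
  exists modV : mxmodule rG V, mx_rsim (submod_repr modV) rho.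

Definition complete_irr_list (F : fieldType) (gT : finGroupType)
    (G : {group gT}) (n k : nat) (psi : 'I_k -> mx_representation F G n) : Prop :=
  [/\ forall j, mx_irreducible (psi j),
      forall i j, i != j -> ~ mx_rsim (psi i) (psi j) &
      forall rho : mx_representation F G n,
        mx_irreducible rho -> exists j, mx_rsim (psi j) rho].

(* Main.v *)
Require Import Defs.
From mathcomp Require Import all_boot all_order all_algebra all_fingroup.
From mathcomp Require Import mxrepresentation finfield reals complex.
From mathcomp Require Import ring.

Set Implicit Arguments.
Unset Strict Implicit.
Unset Printing Implicit Defensive.

Import GroupScope GRing.Theory Num.Theory.
Local Open Scope ring_scope.

(** The proof diagonalises the translations by a discrete Fourier transform.
    Let [z] be a primitive [p]-th root of unity and let
    [w_k = \sum_i z ^ (k i) v_i], for [k] in [Z_p]; these vectors are the rows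
    of an invertible matrix [fourier], hence a basis of the quandle ring.

    Connectedness forces [t != 1], so [Inn] contains every translation
    [x |-> x + b]. The vector [w_k] is an eigenvector of all translations, with
    character [b |-> z ^ (- k b)], and these characters are distinct for
    distinct [k]. Hence a submodule containing a vector [u] also contains every
    [w_l] on which the Fourier coefficient of [u] is nonzero
    ([mxmodule_fourier]). On the other hand a generator [R_y] sends [w_k] to a
    multiple of [w_(k / t)] ([row_fourier_rtrans]). So the span [orbit_module k]
    of the [w_l], for [l] in the coset [k <t>], is a submodule and is simple
    ([orbit_module_simple]); it has dimension [n] if [k != 0] and is the trivial
    line if [k = 0]. Two such submodules are isomorphic only if the cosets are
    equal, since an isomorphism preserves the characters of the translations
    ([mx_iso_orbit_module]).

    It remains to match cosets with the given list [psi]. Since the list is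
    complete, each nonzero [k] gets an index [J k] such that [orbit_module k]
    affords [psi (J k)]. Each fibre of [J] lies in one coset, which has [n]
    elements, while [J] maps [p - 1] elements into [(p - 1) / n] indices; thus
    every index is reached ([torbit_transversal]), and choosing a preimage of
    each one gives the modules [V j]. Together with the trivial line they
    contain all the [w_k], so they span, and their dimensions add up to
    [1 + (p - 1) = p], so the sum is direct. *)

(** * Roots of unity of prime order *)

(** A root of [1 + X + ... + X ^ (p - 1)] is a [p]-th root of unity, and it
    differs from [1], where this polynomial takes the value [p]. *)
Lemma prime_prim_root_exists (F : closedFieldType) (p : nat) :
  prime p -> p%:R != 0 :> F -> exists z : F, p.-primitive_root z.
Proof.
move=> p_pr pF; have p_gt1 := prime_gt1 p_pr.
pose c : {poly F} := \poly_(i < p) 1.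
have /closed_rootP[z /rootP cz0] : size c != 1%N.
  by rewrite size_poly_eq ?oner_eq0 // neq_ltn p_gt1 orbT.
have cE x : c.[x] = \sum_(i < p) x ^+ i.
  by rewrite horner_poly; apply: eq_bigr => i _; rewrite mul1r.
have zp1 : z ^+ p = 1.
  by apply/eqP; rewrite -subr_eq0 subrX1 -cE cz0 mulr0.
have [m zm] := prim_order_exists (ltnW p_gt1) zp1.
case/primeP: p_pr => _ /[apply] /orP[] /eqP mE; last by exists z; rewrite -mE.
have z1 : z = 1 by have := prim_expr_order zm; rewrite mE expr1.
case/eqP: pF; rewrite -cz0 cE z1 -[p in LHS]card_ord -sumr_const.
by apply: eq_bigr => i _; rewrite expr1n.
Qed.

(** * Right ideals are submodules *)

Section RightIdeals.
Variables (F : fieldType) (m : nat) (Q : quandle 'I_m).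

(** Right multiplication by [w] is a combination of the generators of [Inn];
    this is what makes right ideals and submodules agree. *)
Lemma qmul_rtrans (u w : 'rV[F]_m) :
  qmul Q u w = \sum_j w 0 j *: (u *m perm_mx (rtrans Q j)).
Proof.
rewrite /qmul exchange_big; apply: eq_bigr => j _.
rewrite {2}(row_sum_delta u) mulmx_suml scaler_sumr; apply: eq_bigr => i _.
rewrite mulrC -scalerA -scalemxAl; congr (_ *: (_ *: _)).
by rewrite (qrepr_basis _ Q) permE.
Qed.

Lemma rtrans_Inn j : rtrans Q j \in Inn Q.
Proof. exact/mem_gen/imset_f. Qed.

(** The stabiliser of a subspace is a subgroup of the finite group [Inn], so it
    is all of [Inn] as soon as it contains the generators. *)
Lemma mxmodule_InnP (V : 'M[F]_m) :
  reflect (forall y, (V *m perm_mx (rtrans Q y) <= V)%MS)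
          (mxmodule (qrepr F Q) V).
Proof.
apply: (iffP idP) => [/mxmoduleP modV y | rV].
  exact: modV (rtrans_Inn y).
rewrite /mxmodule gen_subG; apply/subsetP=> _ /imsetP[y _ ->].
by rewrite inE rtrans_Inn /=.
Qed.

Lemma right_ideal_mxmodule (V : 'M[F]_m) :
  right_ideal Q V <-> mxmodule (qrepr F Q) V.
Proof.
split=> [idV | /mxmodule_InnP modV u w uV].
  apply/mxmodule_InnP=> y; apply/row_subP=> i; rewrite row_mul.
  have := idV _ (qbasis F y) (row_sub i V); rewrite qmul_rtrans (bigD1 y) //=.
  rewrite big1 => [|j njy]; last by rewrite mxE (negPf njy) andbF scale0r.
  by rewrite addr0 mxE !eqxx scale1r.
rewrite qmul_rtrans; apply: summx_sub => j _; apply: scalemx_sub.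
exact: submx_trans (submxMr _ uV) (modV j).
Qed.

Lemma simple_right_idealP (V : 'M[F]_m) :
  simple_right_ideal Q V <-> mxsimple (qrepr F Q) V.
Proof.
split=> -[/right_ideal_mxmodule modV nzV minV]; split=> // W.
  by move/right_ideal_mxmodule; apply: minV.
by move/right_ideal_mxmodule; apply: minV.
Qed.

End RightIdeals.

(** * The Fourier basis of the affine quandle ring *)

Section AffineRing.

Variables (p : nat) (p_pr : prime p) (t : 'F_p) (t_neq0 : t != 0).
Variables (F : fieldType) (z : F) (z_prim : p.-primitive_root z).

Local Notation q := (Zp_trunc (pdiv p)).+2.
Local Notation Q := (affine_quandle t_neq0).
Local Notation rG := (qrepr F Q).

(** For [t = 1] the quandle is trivial, so that [Inn] fixes [0]. *)
Lemma connected_affine_neq1 : qconnected Q -> t != 1.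
Proof.
move=> conQ; apply/eqP=> t1.
have Inn1 : Inn Q \subset 1%G.
  rewrite gen_subG; apply/subsetP=> _ /imsetP[y _ ->]; rewrite inE.
  by apply/eqP/permP=> x; rewrite permE perm1 /= t1 mul1r subrr mul0r addr0.
have [g /(subsetP Inn1)] := atransP2 conQ (in_setT (0 : 'F_p)) (in_setT 1).
by rewrite inE => /eqP-> /eqP; rewrite /= apermE perm1 oner_eq0.
Qed.

Definition chi (x : 'F_p) : F := z ^+ x.

Lemma chiD : {morph chi : x y / x + y >-> x * y}.
Proof.
move=> x y; rewrite /chi -exprD -[RHS](prim_expr_mod z_prim) /=.
by congr (_ ^+ (_ %% _)); apply: Fp_cast.
Qed.

Lemma chi0 : chi 0 = 1.
Proof. by rewrite /chi expr0. Qed.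

Lemma chi_eq1 x : (chi x == 1) = (x == 0).
Proof.
rewrite /chi -(prim_order_dvd z_prim); apply/idP/eqP=> [|->]; last exact: dvdn0.
move=> pdvx; apply: val_inj => /=; apply/eqP; rewrite -leqn0 leqNgt.
have ltxp : (x < p)%N by rewrite -[X in (_ < X)%N](Fp_cast p_pr).
by apply/negP=> x_gt0; rewrite gtnNdvd in pdvx.
Qed.

(** Orthogonality: shifting [b] by one multiplies the sum by [chi c]. *)
Lemma sum_chi c : \sum_b chi (b * c) = if c == 0 then p%:R else 0.
Proof.
case: eqP => [-> | /eqP nzc].
  under eq_bigr do rewrite mulr0 chi0.
  by rewrite sumr_const (card_Fp p_pr).
apply/eqP; have: chi c * \sum_b chi (b * c) = \sum_b chi (b * c).
  rewrite mulr_sumr [RHS](reindex_inj (addrI 1)) /=.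
  by apply: eq_bigr => b _; rewrite -chiD; congr chi; ring.
move/eqP; rewrite -subr_eq0 -{2}[\sum_b _]mul1r -mulrBl mulf_eq0 subr_eq0.
by rewrite chi_eq1 (negPf nzc).
Qed.

Definition fourier : 'M[F]_q := \matrix_(k, i) chi (k * i).

(** [p] times the inverse of [fourier]; the entries of [u *m cofourier] are the
    Fourier coefficients of [u]. *)
Definition cofourier : 'M[F]_q := \matrix_(i, l) chi (- (i * l)).

Lemma fourierK : fourier *m cofourier = (p%:R)%:M.
Proof.
apply/matrixP=> k l; rewrite !mxE mulrb.
transitivity (\sum_i chi (i * (k - l))).
  by apply: eq_bigr => i _; rewrite !mxE -chiD; congr chi; ring.
by rewrite sum_chi subr_eq0.
Qed.

Lemma fourier_units : (fourier \in unitmx) && (cofourier \in unitmx).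
Proof.
have: fourier *m ((p%:R)^-1 *: cofourier) = 1%:M.
  rewrite -scalemxAr fourierK scale_scalar_mx.
  by rewrite mulVf ?(prim_root_natf_neq0 z_prim).
case/mulmx1_unit=> -> unitC; rewrite -(@unitmxZ _ _ (p%:R)^-1) //.
by rewrite unitfE invr_neq0 ?(prim_root_natf_neq0 z_prim).
Qed.

Lemma row_fourier_neq0 (l : 'F_p) : row l fourier != 0.
Proof.
by apply/eqP=> /rowP/(_ 0)/eqP; rewrite !mxE mulr0 chi0 oner_eq0.
Qed.

Definition translation (b : 'F_p) : {perm 'I_q} := perm (addIr b).

Lemma mulmx_perm (u : 'rV[F]_q) (s : {perm 'I_q}) i :
  (u *m perm_mx s) 0 (s i) = u 0 i.
Proof. by rewrite -[s in perm_mx s]invgK -col_permE mxE permK. Qed.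

Lemma row_permP (u v : 'rV[F]_q) (s : {perm 'I_q}) :
  (forall i, u 0 (s i) = v 0 (s i)) -> u = v.
Proof. by move=> e; apply/rowP=> j; rewrite -(permKV s j). Qed.

Lemma row_fourier_rtrans l y :
  row l fourier *m perm_mx (rtrans Q y) =
  chi (- (l * t^-1 * (1 - t) * y)) *: row (l * t^-1) fourier.
Proof.
apply: (@row_permP _ _ (rtrans Q y)) => i.
by rewrite mulmx_perm !mxE permE -chiD /=; congr chi; field.
Qed.

Lemma row_fourier_translation l b :
  row l fourier *m perm_mx (translation b) = chi (- (l * b)) *: row l fourier.
Proof.
apply: (@row_permP _ _ (translation b)) => i.
by rewrite mulmx_perm !mxE permE -chiD; congr chi; ring.
Qed.

(** Up to the factor [p], summing the translates of [u] against a character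
    projects [u] onto the eigenline of that character. *)
Lemma translation_projection (u : 'rV[F]_q) l :
  \sum_b chi (l * b) *: (u *m perm_mx (translation b)) =
  (u *m cofourier) 0 l *: row l fourier.
Proof.
apply/rowP=> j; rewrite summxE !mxE mulr_suml.
rewrite (reindex_inj (@subrI _ (j : 'F_p))) /=; apply: eq_bigr => i _.
have uij : (u *m perm_mx (translation ((j : 'F_p) - i))) 0 j = u 0 i.
  have {2}-> : j = translation ((j : 'F_p) - i) i by rewrite permE addrC subrK.
  exact: mulmx_perm.
rewrite [LHS]mxE uij !mxE mulrC -mulrA -chiD; congr (_ * chi _); ring.
Qed.

(** [R_0] is the multiplication by [t], and [R_y] is the same followed by the
    translation by [(1 - t) y]. *)
Lemma translation_Inn b : t != 1 -> translation b \in Inn Q.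
Proof.
rewrite eq_sym -subr_eq0 => t1.
suff -> : translation b = ((rtrans Q 0)^-1 * rtrans Q (b / (1 - t))%R)%g.
  by rewrite groupM ?groupV ?rtrans_Inn.
apply/permP=> x; rewrite permM -{1}(permKV (rtrans Q 0) x).
by move: ((rtrans Q 0)^-1 x)%g => y; rewrite !permE /=; field.
Qed.

(** * The simple modules attached to the cosets of the powers of t *)

Section Modules.
Hypothesis t_neq1 : t != 1.

Lemma mxmodule_fourier (U : 'M[F]_q) (u : 'rV_q) l :
    mxmodule rG U -> (u <= U)%MS -> (u *m cofourier) 0 l != 0 ->
  (row l fourier <= U)%MS.
Proof.
move=> /mxmoduleP modU uU nz; rewrite -(eqmx_scale _ nz).
rewrite -translation_projection; apply: summx_sub => b _; apply: scalemx_sub.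
exact: submx_trans (submxMr _ uU) (modU _ (translation_Inn b t_neq1)).
Qed.

(** On an eigenvector all the terms of [translation_projection] are equal to
    [v], so the projection is [p *: v]. *)
Lemma translation_eigenvector (v : 'rV[F]_q) l : v != 0 ->
    (forall b, v *m perm_mx (translation b) = chi (- (l * b)) *: v) ->
  (v *m cofourier) 0 l != 0.
Proof.
move=> nzv eigv; apply/eqP=> v0.
have := translation_projection v l; rewrite v0 scale0r => /eqP.
under eq_bigr do rewrite eigv scalerA -chiD subrr chi0 scale1r.
rewrite sumr_const (card_Fp p_pr) -scaler_nat scaler_eq0 (negPf nzv) orbF.
by rewrite (negPf (prim_root_natf_neq0 z_prim)).
Qed.

Variables (n : nat) (t_order : n.-primitive_root t).

(** An enumeration of the coset of [k] modulo the powers of [t]: it is injective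
    for [k != 0], and constant for [k = 0], where the module below is the
    trivial line. *)
Definition torbit (k : 'F_p) (i : 'I_n) : 'F_p := k * t ^+ i.

Definition orbit_module (k : 'F_p) : 'M[F]_q :=
  <<rowsub (torbit k) fourier>>%MS.

Lemma row_orbit_module (k : 'F_p) i :
  (row (k * t ^+ i)%R fourier <= orbit_module k)%MS.
Proof.
have n_gt0 := prim_order_gt0 t_order.
rewrite -(prim_expr_mod t_order) genmxE.
have -> : k * t ^+ (i %% n) = torbit k (Ordinal (ltn_pmod i n_gt0)) by [].
by rewrite -row_rowsub row_sub.
Qed.

Lemma orbit_module_mxmodule (k : 'F_p) : mxmodule rG (orbit_module k).
Proof.
apply/mxmodule_InnP=> y; rewrite (eqmxMr _ (genmxE _)); apply/row_subP=> i.
rewrite row_mul row_rowsub row_fourier_rtrans scalemx_sub //.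
have -> : torbit k i * t^-1 = k * t ^+ (i + n.-1).
  rewrite exprD mulrA; congr (_ * _); apply: (mulIf t_neq0).
  rewrite mulVf // -exprSr prednK ?(prim_order_gt0 t_order) //.
  by rewrite (prim_expr_order t_order).
exact: row_orbit_module.
Qed.

(** Linear independence of the Fourier basis: the [l]-th coefficient of a
    combination of other basis vectors vanishes, while that of [w_l] is [p]. *)
Lemma fourier_orbit_module (k l : 'F_p) :
  (row l fourier <= orbit_module k)%MS -> exists i, l = torbit k i.
Proof.
rewrite genmxE => /submxP[D wD].
have [i /eqP-> | nol] := pickP (fun i => l == torbit k i); first by exists i.
have /negP[] := prim_root_natf_neq0 z_prim; apply/eqP.
transitivity ((row l fourier *m cofourier) 0 l).
  by rewrite -row_mul fourierK !mxE eqxx.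
rewrite wD -mulmxA mul_rowsub_mx fourierK mxE big1 // => i _.
by rewrite !mxE eq_sym nol mulr0.
Qed.

Lemma torbit_inj (k : 'F_p) : k != 0 -> injective (torbit k).
Proof.
move=> nzk i j /(mulfI nzk)/eqP; rewrite (eq_prim_root_expr t_order).
by rewrite !modn_small // => /eqP/val_inj.
Qed.

Lemma orbit_module_rank (k : 'F_p) : k != 0 -> \rank (orbit_module k) = n.
Proof.
move=> nzk; rewrite genmxE; apply/eqP; apply/row_freeP.
exists (colsub (torbit k) ((p%:R)^-1 *: cofourier)).
rewrite mul_rowsub_mx mulmx_colsub -scalemxAr fourierK.
apply/matrixP=> i j; rewrite !mxE (inj_eq (torbit_inj nzk)).
by case: eqP => _; rewrite ?mulr0 // mulVf ?(prim_root_natf_neq0 z_prim).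
Qed.

(** The inverse of [R_0] sends [w_l] to [w_(l t)], so [w_k] generates the
    whole module. *)
Lemma orbit_module_min (U : 'M[F]_q) (k : 'F_p) :
  mxmodule rG U -> (row k fourier <= U)%MS -> (orbit_module k <= U)%MS.
Proof.
move=> /mxmoduleP modU wU; rewrite genmxE; apply/row_subP=> i.
rewrite row_rowsub /torbit; elim: (i : nat) => [|j IHj]; first by rewrite mulr1.
have -> : row (k * t ^+ j.+1) fourier =
          row (k * t ^+ j) fourier *m rG (rtrans Q 0)^-1%g.
  apply: (canRL (repr_mxK rG (rtrans_Inn Q 0))).
  rewrite row_fourier_rtrans mulr0 oppr0 chi0 scale1r.
  by rewrite exprSr mulrA mulfK.
apply: submx_trans (submxMr _ IHj) (modU _ _).
by rewrite groupV rtrans_Inn.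
Qed.

Lemma row_orbit_module0 (k : 'F_p) : (row k fourier <= orbit_module k)%MS.
Proof. by have := row_orbit_module k 0; rewrite mulr1. Qed.

Lemma orbit_module_torbit (k : 'F_p) i :
  orbit_module (torbit k i) = orbit_module k.
Proof.
apply/eq_genmx/eqmxP; rewrite -!(genmxE (rowsub _ _)); apply/andP; split.
  by rewrite orbit_module_min ?orbit_module_mxmodule // row_orbit_module.
apply: orbit_module_min; first exact: orbit_module_mxmodule.
have := row_orbit_module (torbit k i) (n - i).
by rewrite -mulrA -exprD subnKC 1?ltnW // (prim_expr_order t_order) mulr1.
Qed.

(** A nonzero submodule [U] has a vector with some nonzero Fourier coefficient,
    so it contains some [w_l]; by linear independence [l] is in the coset of
    [k], and [w_l] generates [orbit_module k]. *)
Lemma orbit_module_simple (k : 'F_p) : mxsimple rG (orbit_module k).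
Proof.
have /andP[_ unitC] := fourier_units.
split; first exact: orbit_module_mxmodule.
  apply: contraTneq (row_orbit_module0 k) => ->; rewrite submx0.
  exact: row_fourier_neq0.
move=> U modU sUV /rowV0Pn[u uU nzu].
have /rV0Pn[l nzl] : u *m cofourier != 0.
  by apply: contraNneq nzu => u0; rewrite -[u](mulmxK unitC) u0 mul0mx.
have wU := mxmodule_fourier modU uU nzl.
have [i def_l] := fourier_orbit_module (submx_trans wU sUV).
by rewrite -(orbit_module_torbit k i) -def_l orbit_module_min.
Qed.

(** An isomorphism [f] maps [w_k] to a nonzero eigenvector of the translations
    with the same character; as it lies in [orbit_module l], so does [w_k]. *)
Lemma mx_iso_orbit_module (k l : 'F_p) :
  mx_iso rG (orbit_module k) (orbit_module l) -> exists i, k = torbit l i.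
Proof.
case=> f f_unit /hom_mxP homf Vf.
have /submxP[D wD] := row_orbit_module0 k.
pose v := row k fourier *m f.
apply: fourier_orbit_module.
apply: (@mxmodule_fourier _ v); first exact: orbit_module_mxmodule.
  by rewrite -Vf submxMr // row_orbit_module0.
apply: translation_eigenvector => [|b].
  apply: contraNneq (row_fourier_neq0 k) => v0.
  by rewrite -[X in X == _](mulmxK f_unit) -/v v0 mul0mx.
have:= homf _ (translation_Inn b t_neq1) => /(congr1 (mulmx D)).
rewrite !mulmxA -wD -/v => <-.
by rewrite row_fourier_translation -scalemxAl.
Qed.

Lemma V_triv_orbit : V_triv F q = orbit_module 0.
Proof.
have w0 : v_triv F q = row 0 fourier.
  apply/rowP=> j; rewrite !mxE mul0r chi0 summxE (bigD1 j) //= mxE !eqxx.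
  by rewrite big1 ?addr0 // => i nij; rewrite mxE eq_sym (negPf nij).
have torbit0 i : torbit 0 i = 0 by rewrite /torbit mul0r.
rewrite /V_triv w0; apply/eq_genmx/eqmxP/andP; split.
  by have := row_orbit_module0 0; rewrite genmxE.
by apply/row_subP=> i; rewrite row_rowsub torbit0.
Qed.

(** * Matching the cosets with a list of representations *)

Lemma torbit_order_dvd : (n %| p - 1)%N.
Proof.
rewrite (prim_order_dvd t_order); apply/eqP/(mulfI t_neq0).
rewrite mulr1 -exprS subn1 prednK ?prime_gt0 // -[X in _ ^+ X](card_Fp p_pr).
exact: expf_card.
Qed.

(** Counting: the fibres of [J] have at most [n] elements, and [N] of them are
    needed to cover the [N * n] nonzero elements. *)
Lemma torbit_transversal (N : nat) (J : 'F_p -> 'I_N) : (N * n = p - 1)%N ->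
    (forall k l, k != 0 -> l != 0 -> J k = J l -> exists i, k = torbit l i) ->
  forall j, exists2 k, k != 0 & J k = j.
Proof.
move=> Nn J_orbit; pose A := [set k : 'F_p | k != 0].
have inA k : (k \in A) = (k != 0) by rewrite /A inE.
have n_gt0 := prim_order_gt0 t_order.
have cardA : #|A| = (p - 1)%N.
  by rewrite cardsE cardC1 (card_Fp p_pr) subn1.
have fiber j : (\sum_(k in A | J k == j) 1 <= (j \in J @: A) * n)%N.
  have [/imsetP[l Al def_j] | notJj] := boolP (j \in J @: A); last first.
    rewrite big1 // => k /andP[Ak /eqP Jk].
    by case/imsetP: notJj; exists k.
  rewrite mul1n sum1_card -[X in (_ <= X)%N]card_ord -cardsT.
  apply: leq_trans (leq_imset_card (torbit l) _).
  apply/subset_leq_card/subsetP=> k.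
  rewrite unfold_in inA => /andP[nzk /eqP Jk].
  have nzl : l != 0 by rewrite -inA.
  have [|i ->] := J_orbit k l nzk nzl; first by rewrite Jk.
  exact: imset_f.
have ltNA : (N <= #|J @: A|)%N.
  rewrite -(leq_pmul2r n_gt0) Nn -cardA.
  rewrite -sum1_card (partition_big J predT) //=.
  rewrite -(sum1_card (mem (J @: A))) big_distrl /=.
  rewrite [X in (_ <= X)%N]big_mkcond /=.
  by apply: leq_sum => j _; apply: leq_trans (fiber j) _; case: (j \in _).
move=> j; have /imsetP[k] : j \in J @: A.
  suff -> : J @: A = setT by rewrite inE.
  by apply/eqP; rewrite eqEcard subsetT cardsT card_ord.
by rewrite inA; exists k.
Qed.

(** Stated over any field with a primitive [p]-th root of unity, which is what
    the Fourier basis requires. *)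
Lemma affine_ring_decomposition
    (psi : 'I_((p - 1) %/ n) -> mx_representation F (Inn Q) n) :
    complete_irr_list psi ->
  exists V : 'I_((p - 1) %/ n) -> 'M[F]_q,
    [/\ (V_triv F _ + \sum_j V j == 1%:M)%MS,
        mxdirect (V_triv F _ + \sum_j V j),
        simple_right_ideal Q (V_triv F _) &
        forall j, [/\ simple_right_ideal Q (V j), mxsimple rG (V j) &
                      affords rG (V j) (psi j)]].
Proof.
case=> _ _ psi_all.
(* The modules have dimension n only up to a provable equality, whereas psi
   is complete for representations of degree n on the nose. *)
have cover m (rho : mx_representation F (Inn Q) m) :
    m = n -> mx_irreducible rho -> exists j, mx_rsim (psi j) rho.
  by move=> mn; move: rho; rewrite mn; apply: psi_all.
pose sr k := submod_repr (orbit_module_mxmodule k).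
have class1 k : k != 0 -> exists j, mx_rsim (psi j) (sr k).
  move=> nzk; apply: cover; first exact: orbit_module_rank.
  by apply/submod_mx_irr; apply: orbit_module_simple.
(* At k = 0 any index will do; one exists because k = 1 has one. *)
have class k : exists j, k != 0 -> mx_rsim (psi j) (sr k).
  have [-> | /class1[j]] := eqVneq k 0; last by exists j.
  by have [j _] := class1 1 (oner_neq0 _); exists j.
have [J psiJ] := fin_all_exists class.
have J_orbit k l : k != 0 -> l != 0 -> J k = J l -> exists i, k = torbit l i.
  move=> nzk nzl Jkl; apply: mx_iso_orbit_module.
  apply/(mx_rsim_iso (orbit_module_mxmodule k) (orbit_module_mxmodule l)).
  apply: mx_rsim_trans (psiJ l nzl); rewrite -Jkl.
  exact/mx_rsim_sym/psiJ.
have reached := torbit_transversal (divnK torbit_order_dvd) J_orbit.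
have [r nzr Jr] := fin_all_exists2 reached.
exists (fun j => orbit_module (r j)).
(* Each w_k lies in V_triv or in the module of the representative of its
   coset. *)
have sumV : (V_triv F q + \sum_j orbit_module (r j) :=: 1%:M)%MS.
  apply/eqmxP; rewrite submx1 /=.
  have /andP[unitW _] := fourier_units.
  have: row_full fourier by rewrite row_full_unit.
  rewrite -sub1mx => /submx_trans-> //; apply/row_subP=> k.
  have [-> | nzk] := eqVneq k 0.
    by rewrite V_triv_orbit (submx_trans (row_orbit_module0 0)) ?addsmxSl.
  have [i def_k] := J_orbit k (r (J k)) nzk (nzr _) (esym (Jr _)).
  apply: submx_trans (addsmxSr _ _); apply: (sumsmx_sup (J k)) => //.
  by rewrite {1}def_k; apply: row_orbit_module.
have rank_triv : \rank (V_triv F q) = 1%N.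
  have [_ nz _] := orbit_module_simple 0; move: nz; rewrite -V_triv_orbit.
  by rewrite -mxrank_eq0 genmxE rank_rV; case: (v_triv F q != 0).
split; first exact/eqmxP.
- rewrite mxdirectE /= sumV mxrank1 rank_triv.
  under eq_bigr do rewrite orbit_module_rank ?nzr //.
  rewrite sum_nat_const card_ord divnK ?torbit_order_dvd //.
  by rewrite subnKC ?prime_gt0 // Fp_cast.
- by apply/simple_right_idealP; rewrite V_triv_orbit; apply: orbit_module_simple.
move=> j; have simV := orbit_module_simple (r j).
split=> //; first exact/simple_right_idealP.
exists (orbit_module_mxmodule (r j)); apply: mx_rsim_sym.
by rewrite -{1}(Jr j); apply: psiJ.
Qed.

End Modules.
End AffineRing.

Theorem theorem6p2 (R : realType) (p : nat) (p_prime : prime p)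
    (t : 'F_p) (t_neq0 : t != 0)
    (A_connected : qconnected (affine_quandle t_neq0))
    (n : nat) (t_order : n.-primitive_root t)
    (psi : 'I_((p - 1) %/ n)%N ->
           mx_representation R[i] (Inn (affine_quandle t_neq0)) n)
    (psi_complete : complete_irr_list psi) :
  exists V : 'I_((p - 1) %/ n)%N -> 'M[R[i]]_((Zp_trunc (pdiv p)).+2),
    [/\ (V_triv R[i] _ + \sum_j V j == 1%:M)%MS,
        mxdirect (V_triv R[i] _ + \sum_j V j),
        simple_right_ideal (affine_quandle t_neq0) (V_triv R[i] _) &
        forall j,
          [/\ simple_right_ideal (affine_quandle t_neq0) (V j),
              mxsimple (qrepr R[i] (affine_quandle t_neq0)) (V j) &
              affords (qrepr R[i] (affine_quandle t_neq0)) (V j) (psi j)]].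
Proof.
have t_neq1 := connected_affine_neq1 A_connected.
have p_neq0 : p%:R != 0 :> R[i] by rewrite pnatr_eq0 -lt0n prime_gt0.
have [z z_prim] := prime_prim_root_exists p_prime p_neq0.
exact: (affine_ring_decomposition p_prime z_prim t_neq1 t_order psi_complete).
Qed.
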